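(* Let $n$ and $k$ be positive integers, let $U=V\oplus\mathbb{C}$ be the direct sum of the natural representation $V=\mathbb{C}^n$ and the trivial representation $\mathbb{C}$ of the symmetric inverse semigroup $\mathcal{IS}_n$, let $\mathcal{IS}_n$ act diagonally on $U^{\otimes k}$, and let the partial dual symmetric inverse semigroup $\mathcal{PI}^*_k$ act (from the right) on $U^{\otimes k}$ as described in the context. Then: (i) The actions of $\mathcal{IS}_n$ and $\mathcal{PI}^*_k$ on $U^{\otimes k}$ commute. (ii) $\mathrm{End}_{\mathcal{IS}_n}(U^{\otimes k})$ coincides with the image of $\mathbb{C}[\mathcal{PI}^*_k]$ in $\mathrm{End}_{\mathbb{C}}(U^{\otimes k})$. (iii) $\mathrm{End}_{\mathcal{PI}^*_k}(U^{\otimes k})$ coincides with the image of $\mathbb{C}[\mathcal{IS}_n]$ in $\mathrm{End}_{\mathbb{C}}(U^{\otimes k})$. (iv) The representation of $\mathcal{IS}_n$ on $U^{\otimes k}$ is faithful. (v) The representation of $\mathcal{PI}^*_k$ on $U^{\otimes k}$ is faithful. (vi) The representation of $\mathbb{C}[\mathcal{IS}_n]$ on $U^{\otimes k}$ is faithful if and only if $k\geq n$. (vii) The representation of $\mathbb{C}[\mathcal{PI}^*_k]$ on $U^{\otimes k}$ is faithful if and only if $k\leq n$.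
   Context: General notation. $n,k$ are fixed positive integers; $\mathbf{N}=\{1,\dots,n\}$, $\mathbf{K}=\{1,\dots,k\}$, $\mathbf{K}'=\{1',\dots,k'\}$ (a disjoint copy of $\mathbf{K}$), $\tilde{\mathbf{K}}=\mathbf{K}\cup\mathbf{K}'$. For a semigroup $S$, $\mathbb{C}[S]$ is the (full, non-contracted) semigroup algebra over $\mathbb{C}$. A representation of a semigroup or of an algebra is faithful if the corresponding map to the linear operators is injective. For a semigroup $S$ acting linearly on $W$, $\mathrm{End}_S(W)$ is the algebra of linear operators on $W$ commuting with the action of every element of $S$. The semigroup $\mathcal{IS}_n$ and the module $U$. $\mathcal{IS}_n$ is the semigroup of all partial injective maps $\mathbf{N}\to\mathbf{N}$ (injective maps $A\to\mathbf{N}$ with $A\subset\mathbf{N}$), under composition of partial maps (from right to left). On $V=\mathbb{C}^n$ with standard basis $e_1,\dots,e_n$ the natural representation is: $\pi e_i=e_{\pi(i)}$ if $i$ is in the domain of $\pi$, and $\pi e_i=0$ otherwise. The trivial module is $\mathbb{C}$ with basis element $e_0$, on which all elements of $\mathcal{IS}_n$ (including the nowhere defined map) act as the identity. $U=V\oplus\mathbb{C}$ has basis $e_0,e_1,\dots,e_n$, and $\mathcal{IS}_n$ acts on $U^{\otimes k}$ by $\pi(x_1\otimes\dots\otimes x_k)=\pi x_1\otimes\dots\otimes\pi x_k$. The semigroup $\mathcal{PI}^*_k$. Its elements are all partitions $\alpha$ of subsets $A\subset\tilde{\mathbf{K}}$ (including $A=\varnothing$) into nonempty blocks such that each block intersects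 both $\mathbf{K}$ and $\mathbf{K}'$ non-trivially. Product $\alpha\beta$: identify each element $j'$ of $\mathbf{K}'$ for $\alpha$ with the element $j$ of $\mathbf{K}$ for $\beta$, obtaining three copies of $\mathbf{K}$ (the unprimed elements of $\alpha$, the middle elements, the primed elements of $\beta$). Take the finest partition of the union of the three copies for which every block of $\alpha$ and every block of $\beta$ is contained in a single part. Call a part good if each of its unprimed elements belongs to a block of $\alpha$, each of its primed elements belongs to a block of $\beta$, and each of its middle elements belongs both to a block of $\alpha$ and to a block of $\beta$. The blocks of $\alpha\beta$ are the intersections of the good parts with the set of unprimed elements of $\alpha$ and primed elements of $\beta$; all other elements belong to no block of $\alpha\beta$. Action of $\mathcal{PI}^*_k$ on $U^{\otimes k}$. For $\mathbf{i}=(i_1,\dots,i_k)\in(\mathbf{N}\cup\{0\})^k$ put $v_{\mathbf{i}}=e_{i_1}\otimes\dots\otimes e_{i_k}$; these vectors form a basis of $U^{\otimes k}$. For $\alpha\in\mathcal{PI}^*_k$ let $M(\alpha,\mathbf{i})$ be the set of all $\mathbf{l}=(l_1,\dots,l_k)\in(\mathbf{N}\cup\{0\})^k$ such that: for each block $\{a_1,\dots,a_p,b_1',\dots,b_q'\}$ of $\alpha$ (with $a_s,b_t\in\mathbf{K}$) one has $i_{a_1}=\dots=i_{a_p}=l_{b_1}=\dots=l_{b_q}$; and $i_a=0$ for every $a\in\mathbf{K}$ which belongs to no block of $\alpha$, and $l_b=0$ for every $b\in\mathbf{K}$ such that $b'$ belongs to no block of $\alpha$. (This set has at most one element.) Then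 $\alpha$ acts as the unique linear operator with $\alpha(v_{\mathbf{i}})=\sum_{\mathbf{l}\in M(\alpha,\mathbf{i})}v_{\mathbf{l}}$ (which is $0$ if $M(\alpha,\mathbf{i})=\varnothing$). This defines a right action: the operator of $\alpha\beta$ is obtained by applying first the operator of $\alpha$ and then that of $\beta$. The image of $\mathbb{C}[\mathcal{PI}^*_k]$ is the linear span of these operators. *)

(* Defs.v *)
(* MathComp. Everything is defined over an arbitrary field F, to be instantiated
   with the complex numbers R[i], R : realType. *)
From HB Require Import structures.
From mathcomp Require Import all_boot all_order all_algebra.
Set Implicit Arguments.
Unset Strict Implicit.
Unset Printing Implicit Defensive.
Import GRing.Theory.
Local Open Scope ring_scope.

(* [{ffun I -> F^o}] is the vector space with basis indexed by I. *)
Definition basisv (F : fieldType) (I : finType) (i : I) : {ffun I -> F^o} :=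
  [ffun j => (i == j)%:R].

Definition lin_ext (F : fieldType) (I : finType) (W : vectType F) (g : I -> W)
  (t : {ffun I -> F^o}) : W := \sum_i t i *: g i.

Lemma lin_ext_is_linear (F : fieldType) (I : finType) (W : vectType F)
  (g : I -> W) : linear (lin_ext g).
Proof.
move=> a s t; rewrite /lin_ext scaler_sumr -big_split /=.
by apply: eq_bigr => i _; rewrite !ffunE scalerDl scalerA.
Qed.

HB.instance Definition _ (F : fieldType) (I : finType) (W : vectType F)
  (g : I -> W) :=
  GRing.isLinear.Build F {ffun I -> F^o} W _ (lin_ext g) (lin_ext_is_linear g).

Lemma lin_ext_basis (F : fieldType) (I : finType) (W : vectType F)
  (g : I -> W) i : lin_ext g (basisv F i) = g i.
Proof.
rewrite /lin_ext (bigD1 i) //= ffunE eqxx scale1r big1 ?addr0 // => j /negPf ji.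
by rewrite ffunE eq_sym ji scale0r.
Qed.

Lemma basisv_sum (F : fieldType) (I : finType) (t : {ffun I -> F^o}) :
  t = \sum_i t i *: basisv F i.
Proof.
apply/ffunP=> j; rewrite sum_ffunE (bigD1 j) //= big1 ?addr0.
  by rewrite !ffunE eqxx [RHS]mulr1.
by move=> i /negPf ij; rewrite !ffunE ij [LHS]mulr0.
Qed.

Lemma lfun_basis_eq (F : fieldType) (I : finType) (W : vectType F)
  (f g : 'Hom({ffun I -> F^o}, W)) :
  (forall i, f (basisv F i) = g (basisv F i)) -> f = g.
Proof.
move=> fg; apply/lfunP=> t; rewrite (basisv_sum t) !linear_sum.
by apply: eq_bigr => i _; rewrite !linearZ /= fg.
Qed.

(* The semigroup algebra F[S] is {ffun S -> F^o} with the convolution product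
   below (basisv F s is the element s). A family of operators rho : S -> 'End(W)
   extends linearly to F[S]. *)
Definition salg_mul (F : fieldType) (S : finType) (op : S -> S -> S)
  (a b : {ffun S -> F^o}) : {ffun S -> F^o} :=
  \sum_x \sum_y (a x * b y) *: basisv F (op x y).

Definition alg_rep (F : fieldType) (S : finType) (W : vectType F)
  (rho : S -> 'End(W)) : {ffun S -> F^o} -> 'End(W) := lin_ext rho.

Lemma comp_lfun_suml (F : fieldType) (I : finType) (U V W : vectType F)
  (f : I -> 'Hom(V, W)) (g : 'Hom(U, V)) :
  ((\sum_i f i) \o g = \sum_i (f i \o g))%VF.
Proof.
by apply/lfunP=> v; rewrite comp_lfunE !sum_lfunE; apply: eq_bigr => i _; rewrite comp_lfunE.
Qed.

Lemma comp_lfun_sumr (F : fieldType) (I : finType) (U V W : vectType F)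
  (f : 'Hom(V, W)) (g : I -> 'Hom(U, V)) :
  (f \o (\sum_i g i) = \sum_i (f \o g i))%VF.
Proof.
apply/lfunP=> v; rewrite comp_lfunE !sum_lfunE linear_sum.
by apply: eq_bigr => i _; rewrite comp_lfunE.
Qed.

Lemma alg_rep_mul (F : fieldType) (S : finType) (op : S -> S -> S)
  (W : vectType F) (rho : S -> 'End(W)) :
  (forall s t, rho (op s t) = (rho s \o rho t)%VF) ->
  forall a b, alg_rep rho (salg_mul op a b) = (alg_rep rho a \o alg_rep rho b)%VF.
Proof.
move=> rhoM a b; rewrite /alg_rep /salg_mul linear_sum /=.
rewrite [in RHS]/lin_ext comp_lfun_suml; apply: eq_bigr => x _.
rewrite linear_sum /= comp_lfun_sumr; apply: eq_bigr => y _.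
by rewrite linearZ /= lin_ext_basis rhoM -comp_lfunZl -comp_lfunZr scalerA.
Qed.

Lemma alg_rep_mul_right (F : fieldType) (S : finType) (op : S -> S -> S)
  (W : vectType F) (rho : S -> 'End(W)) :
  (forall s t, rho (op s t) = (rho t \o rho s)%VF) ->
  forall a b, alg_rep rho (salg_mul op a b) = (alg_rep rho b \o alg_rep rho a)%VF.
Proof.
move=> rhoM a b; rewrite /alg_rep /salg_mul linear_sum /=.
rewrite [in RHS]/lin_ext comp_lfun_sumr; apply: eq_bigr => x _.
rewrite linear_sum /= comp_lfun_suml; apply: eq_bigr => y _.
by rewrite linearZ /= lin_ext_basis rhoM -comp_lfunZl -comp_lfunZr scalerA mulrC.
Qed.

Definition alg_image (F : fieldType) (S : finType) (W : vectType F)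
  (rho : S -> 'End(W)) (f : 'End(W)) : Prop := exists a, f = alg_rep rho a.

Definition commutant (F : fieldType) (S : finType) (W : vectType F)
  (rho : S -> 'End(W)) (f : 'End(W)) : Prop :=
  forall s, (f \o rho s = rho s \o f)%VF.

(* A partial map is a function to option; None means undefined. *)
Definition partial_inj (n : nat) (f : {ffun 'I_n -> option 'I_n}) : bool :=
  [forall i, forall j, (f i == f j) && (f i != None) ==> (i == j)].

Record IS (n : nat) :=
  MkIS { IS_fun :> {ffun 'I_n -> option 'I_n}; IS_inj : partial_inj IS_fun }.

HB.instance Definition _ (n : nat) := [isSub for @IS_fun n].
HB.instance Definition _ (n : nat) := [Finite of IS n by <:].

Definition IS_comp (n : nat) (f g : IS n) : {ffun 'I_n -> option 'I_n} :=
  [ffun i => obind f (g i)].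

Lemma IS_comp_inj (n : nat) (f g : IS n) : partial_inj (IS_comp f g).
Proof.
apply/forallP=> i; apply/forallP=> j; apply/implyP; rewrite !ffunE.
have injP (h : IS n) x y : h x = h y -> h x <> None -> x = y.
  move=> e1 e2; have /forallP/(_ x)/forallP/(_ y)/implyP := IS_inj h.
  by move=> H; apply/eqP/H; rewrite e1 eqxx -e1; apply/eqP.
case gi: (g i) => [x|]; case gj: (g j) => [y|] //=; last by rewrite andbF.
  move=> /andP[/eqP e /eqP ne]; have xy := injP f _ _ e ne.
  by apply/eqP/(injP g); rewrite gi // gj xy.
by move=> /andP[/eqP -> ]; rewrite eqxx.
Qed.

Definition IS_mul (n : nat) (f g : IS n) : IS n := MkIS (IS_comp_inj f g).

Lemma IS_mulA (n : nat) : associative (@IS_mul n).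
Proof.
by move=> f g h; apply/val_inj/ffunP=> i; rewrite !ffunE; case: (h i) => //= j; rewrite ffunE.
Qed.

HB.instance Definition _ (n : nat) := isSemigroup.Build (IS n) (@IS_mulA n).

Definition modV (F : fieldType) (n : nat) : vectType F := 'cV[F]_n.
Definition modU (F : fieldType) (n : nat) : vectType F := (modV F n * F^o)%type.

Definition V_act (F : fieldType) (n : nat) (f : IS n) (v : 'cV[F]_n) : 'cV[F]_n :=
  \sum_i v i 0 *: (if f i is Some j then delta_mx j 0 else 0).

Definition U_act (F : fieldType) (n : nat) (f : IS n) (u : modU F n) : modU F n :=
  (V_act f u.1, u.2).

(* The index set {0, 1, ..., n} is option 'I_n, with None in the role of 0. *)
Definition eU (F : fieldType) (n : nat) (i : option 'I_n) : modU F n :=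
  if i is Some j then (delta_mx j 0, 0) else (0, 1).

Definition coordU (F : fieldType) (n : nat) (u : modU F n) (i : option 'I_n) : F :=
  if i is Some j then u.1 j 0 else u.2.

Definition midx (n k : nat) : finType := {ffun 'I_k -> option 'I_n}.

(* The k-th tensor power of U, in coordinates with respect to the basis
   v_i = e_(i_1) (x) ... (x) e_(i_k) (see tens_eU and tens_multilinear). *)
Definition tensU (F : fieldType) (n k : nat) : vectType F := {ffun midx n k -> F^o}.

Definition vT (F : fieldType) (n k : nat) (i : midx n k) : tensU F n k :=
  basisv F i.

(* The decomposable tensor x_1 (x) ... (x) x_k. *)
Definition tens (F : fieldType) (n k : nat) (x : 'I_k -> modU F n) : tensU F n k :=
  [ffun i : midx n k => \prod_j coordU (x j) (i j)].

Definition IS_act (F : fieldType) (n k : nat) (f : IS n) : 'End(tensU F n k) :=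
  linfun (lin_ext (fun i : midx n k => tens (fun j => U_act f (eU F (i j))))).

Lemma coordU_eU (F : fieldType) (n : nat) (i j : option 'I_n) :
  coordU (eU F i) j = (i == j)%:R.
Proof.
case: i j => [i|] [j|] //=; rewrite mxE //.
by rewrite eqxx andbT eq_sym.
Qed.

Lemma tens_eU (F : fieldType) (n k : nat) (i : midx n k) :
  tens (fun j => eU F (i j)) = vT F i.
Proof.
apply/ffunP=> l; rewrite !ffunE; case: eqP => [->|nil].
  by rewrite big1 // => j _; rewrite coordU_eU eqxx.
have [j ij] : exists j, i j != l j.
  apply/existsP; rewrite -negb_forall; apply/negP => /forallP H.
  by apply: nil; apply/ffunP => j; apply/eqP.
by rewrite (bigD1 j) //= coordU_eU (negPf ij) mul0r.
Qed.

Lemma coordU_linear (F : fieldType) (n : nat) (i : option 'I_n) (a : F)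
  (u w : modU F n) : coordU (a *: u + w) i = a * coordU u i + coordU w i.
Proof. by case: i => [i|] //=; rewrite !mxE. Qed.

Lemma tens_multilinear (F : fieldType) (n k : nat) (x : 'I_k -> modU F n)
  (j : 'I_k) (a : F) (u w : modU F n) :
  tens [eta x with j |-> a *: u + w] =
  a *: tens [eta x with j |-> u] + tens [eta x with j |-> w].
Proof.
apply/ffunP=> l; rewrite !ffunE /= !(bigD1 (P := xpredT) j) //= !eqxx.
rewrite coordU_linear mulrDl [in RHS]/GRing.scale /= mulrA.
by congr (_ * _ + _ * _); apply: eq_bigr => i /negPf ->.
Qed.

Lemma coordU_act (F : fieldType) (n : nat) (f : IS n) (u : modU F n) l :
  coordU (U_act f u) l = \sum_i coordU u i * coordU (U_act f (eU F i)) l.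
Proof.
have sumO (g : option 'I_n -> F) : \sum_i g i = g None + \sum_i g (Some i).
  rewrite (bigD1 None) //=; congr (_ + _).
  rewrite (reindex_omap Some id) /=; last by case.
  by apply: eq_bigl => i; rewrite eqxx.
rewrite sumO; case: l => [l|] /=; last first.
  by rewrite mulr1 big1 ?addr0 // => i _; rewrite mulr0.
rewrite {2}/V_act big1 ?mxE ?mulr0 ?add0r; last by move=> i _; rewrite mxE scale0r.
rewrite /V_act summxE; apply: eq_bigr => i _; rewrite mxE; congr (_ * _).
rewrite (bigD1 i) //= big1 ?addr0; first by rewrite [delta_mx _ _ _ _]mxE !eqxx scale1r.
by move=> h /negPf hi; rewrite mxE hi scale0r.
Qed.

Lemma IS_act_tens (F : fieldType) (n k : nat) (f : IS n) (x : 'I_k -> modU F n) :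
  IS_act F k f (tens x) = tens (fun j => U_act f (x j)).
Proof.
rewrite lfunE /=; apply/ffunP=> l; rewrite /lin_ext sum_ffunE ffunE.
under [RHS]eq_bigr do rewrite coordU_act.
rewrite bigA_distr_bigA /=; apply: eq_bigr => i _.
by rewrite !ffunE /GRing.scale /= -big_split.
Qed.

Lemma U_actM (F : fieldType) (n : nat) (f g : IS n) (u : modU F n) :
  U_act (IS_mul f g) u = U_act f (U_act g u).
Proof.
case: u => v c; congr pair; rewrite /= /V_act.
apply/esym; under eq_bigr do rewrite summxE scaler_suml /=.
rewrite exchange_big /=; apply: eq_bigr => i _; rewrite ffunE.
case: (g i) => [j|] /=; last first.
  by rewrite scaler0 big1 // => h _; rewrite mxE scale0r.
rewrite (bigD1 j) //= big1 ?addr0; first by rewrite !mxE !eqxx mulr1.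
by move=> h /negPf hj; rewrite !mxE hj mulr0 scale0r.
Qed.

Lemma IS_actM (F : fieldType) (n k : nat) (f g : IS n) :
  IS_act F k (f * g)%g = (IS_act F k f \o IS_act F k g)%VF.
Proof.
apply: lfun_basis_eq => i; rewrite comp_lfunE -[basisv F i]/(vT F i).
rewrite -tens_eU !IS_act_tens.
by apply/ffunP=> l; rewrite !ffunE; apply: eq_bigr => j _; rewrite U_actM.
Qed.

(* K + K' : inl a is the unprimed element a, inr b the primed element b'. *)
Definition KK (k : nat) : finType := ('I_k + 'I_k)%type.

Definition is_PI (k : nat) (P : {set {set KK k}}) : bool :=
  partition P (cover P) &&
  [forall B in P, [exists a, inl a \in B] && [exists b, inr b \in B]].

Record PI (k : nat) := MkPI { PI_blocks :> {set {set KK k}}; PI_prop : is_PI PI_blocks }.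

HB.instance Definition _ (k : nat) := [isSub for @PI_blocks k].
HB.instance Definition _ (k : nat) := [Finite of PI k by <:].

(* Three copies of K: inl (inl a) is unprimed, inl (inr j) is the middle element
   arising from j' for the left factor and j for the right one, inr b is primed. *)
Definition K3 (k : nat) : finType := ('I_k + 'I_k + 'I_k)%type.

Definition emb_l (k : nat) (x : KK k) : K3 k := inl x.
Definition emb_r (k : nat) (x : KK k) : K3 k :=
  match x with inl j => inl (inr j) | inr b => inr b end.
Definition emb_out (k : nat) (x : KK k) : K3 k :=
  match x with inl a => inl (inl a) | inr b => inr b end.

Definition glue (k : nat) (A B : PI k) : rel (K3 k) := fun x y =>
  [exists C in A : {set {set KK k}}, (x \in @emb_l k @: C) && (y \in @emb_l k @: C)] ||
  [exists C in B : {set {set KK k}}, (x \in @emb_r k @: C) && (y \in @emb_r k @: C)].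

(* The finest partition of K3 for which every block of A and every block of B
   is contained in a single part: see PI_parts_partition, PI_parts_l,
   PI_parts_r and PI_parts_finest. *)
Definition PI_parts (k : nat) (A B : PI k) : {set {set K3 k}} :=
  equivalence_partition (connect (glue A B)) [set: K3 k].

Definition good_elt (k : nat) (A B : PI k) (x : K3 k) : bool :=
  match x with
  | inl (inl a) => inl a \in cover A
  | inl (inr j) => (inr j \in cover A) && (inl j \in cover B)
  | inr b => inr b \in cover B
  end.

Definition good_part (k : nat) (A B : PI k) (P : {set K3 k}) : bool :=
  [forall x in P, good_elt A B x].

Definition PI_comp (k : nat) (A B : PI k) : {set {set KK k}} :=
  [set @emb_out k @^-1: P | P : {set K3 k} in PI_parts A B & good_part A B P].

(* A labelling c of K + K' is compatible with A when it is constant on the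
   blocks of A and takes the value z outside of them. *)
Definition compat (k : nat) (L : eqType) (z : L) (A : PI k) (c : KK k -> L) : bool :=
  [forall C in A : {set {set KK k}}, forall x in C, forall y in C, c x == c y] &&
  [forall x, (x \notin cover A) ==> (c x == z)].

Definition lab (k : nat) (L : Type) (i l : 'I_k -> L) (x : KK k) : L :=
  match x with inl a => i a | inr b => l b end.

Lemma PI_trivIset (k : nat) (A : PI k) : trivIset A.
Proof. by case/andP: (PI_prop A) => /and3P[]. Qed.

Lemma PI_block (k : nat) (A : PI k) (C : {set KK k}) : C \in (A : {set _}) ->
  (exists a, inl a \in C) /\ (exists b, inr b \in C).
Proof.
move=> CA; case/andP: (PI_prop A) => _ /forall_inP/(_ C CA)/andP[].
by move=> /existsP ? /existsP ?.
Qed.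

Lemma PI_coverP (k : nat) (A : PI k) (x : KK k) :
  reflect (exists2 C, C \in (A : {set _}) & x \in C) (x \in cover A).
Proof. exact: bigcupP. Qed.

Lemma PI_block_eq (k : nat) (A : PI k) (C D : {set KK k}) x :
  C \in (A : {set _}) -> D \in (A : {set _}) -> x \in C -> x \in D -> C = D.
Proof.
move=> CA DA xC xD.
by rewrite -(def_pblock (PI_trivIset A) CA xC) (def_pblock (PI_trivIset A) DA xD).
Qed.

Lemma glue_connect_sym (k : nat) (A B : PI k) : connect_sym (glue A B).
Proof.
apply: sym_connect_sym => x y; congr (_ || _); apply: eq_existsb => C;
by congr (_ && _); rewrite andbC.
Qed.

Lemma glue_equiv (k : nat) (A B : PI k) :
  {in [set: K3 k] & &, equivalence_rel (connect (glue A B))}.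
Proof.
move=> x y z _ _ _; split; first exact: connect0.
by move=> xy; apply: same_connect => //; apply: glue_connect_sym.
Qed.

Lemma PI_partsP (k : nat) (A B : PI k) (P : {set K3 k}) :
  reflect (exists x, P = [set y | connect (glue A B) x y]) (P \in PI_parts A B).
Proof.
apply: (iffP imsetP) => [[x _ ->]|[x ->]]; exists x => //;
by apply/setP=> y; rewrite !inE.
Qed.

Lemma glue_l (k : nat) (A B : PI k) (C : {set KK k}) x y :
  C \in (A : {set _}) -> x \in C -> y \in C ->
  connect (glue A B) (emb_l x) (emb_l y).
Proof.
move=> CA xC yC; apply/connect1/orP; left; apply/existsP; exists C.
by rewrite CA !imset_f.
Qed.

Lemma glue_r (k : nat) (A B : PI k) (C : {set KK k}) x y :
  C \in (B : {set _}) -> x \in C -> y \in C ->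
  connect (glue A B) (emb_r x) (emb_r y).
Proof.
move=> CA xC yC; apply/connect1/orP; right; apply/existsP; exists C.
by rewrite CA !imset_f.
Qed.

Lemma glue_ind (k : nat) (A B : PI k) (L : Type) (g : K3 k -> L) :
  (forall C x y, C \in (A : {set _}) -> x \in C -> y \in C ->
     g (emb_l x) = g (emb_l y)) ->
  (forall C x y, C \in (B : {set _}) -> x \in C -> y \in C ->
     g (emb_r x) = g (emb_r y)) ->
  forall u v, connect (glue A B) u v -> g u = g v.
Proof.
move=> gA gB u v /connectP[p]; elim: p u => [|w p IH] u /=; first by move=> _ ->.
move=> /andP[uw pw] vE; rewrite -(IH w pw vE).
case/orP: uw => /existsP[C /and3P[CA /imsetP[x xC ->] /imsetP[y yC ->]]].
  exact: gA CA xC yC.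
exact: gB CA xC yC.
Qed.

Lemma PI_parts_partition (k : nat) (A B : PI k) :
  partition (PI_parts A B) [set: K3 k].
Proof. exact/equivalence_partitionP/glue_equiv. Qed.

Lemma PI_parts_l (k : nat) (A B : PI k) (C : {set KK k}) :
  C \in (A : {set _}) -> exists2 P, P \in PI_parts A B & @emb_l k @: C \subset P.
Proof.
move=> CA; have [[a aC] _] := PI_block CA.
exists [set y | connect (glue A B) (emb_l (inl a)) y]; first by apply/PI_partsP; eexists.
by apply/subsetP=> _ /imsetP[y yC ->]; rewrite inE; apply: glue_l CA aC yC.
Qed.

Lemma PI_parts_r (k : nat) (A B : PI k) (C : {set KK k}) :
  C \in (B : {set _}) -> exists2 P, P \in PI_parts A B & @emb_r k @: C \subset P.
Proof.
move=> CB; have [[a aC] _] := PI_block CB.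
exists [set y | connect (glue A B) (emb_r (inl a)) y]; first by apply/PI_partsP; eexists.
by apply/subsetP=> _ /imsetP[y yC ->]; rewrite inE; apply: glue_r CB aC yC.
Qed.

Lemma PI_parts_finest (k : nat) (A B : PI k) (Q : {set {set K3 k}}) :
  partition Q [set: K3 k] ->
  (forall C, C \in (A : {set _}) -> exists2 P, P \in Q & @emb_l k @: C \subset P) ->
  (forall C, C \in (B : {set _}) -> exists2 P, P \in Q & @emb_r k @: C \subset P) ->
  forall P, P \in PI_parts A B -> exists2 P', P' \in Q & P \subset P'.
Proof.
move=> Qp QA QB _ /PI_partsP[x ->].
have tQ := partition_trivIset Qp.
have inQ y : y \in cover Q by rewrite (cover_partition Qp) inE.
exists (pblock Q x); first exact: pblock_mem.
have H : forall u v, connect (glue A B) u v -> pblock Q u = pblock Q v.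
  apply: glue_ind => C u v CA uC vC; [have [P PQ /subsetP sP] := QA C CA
    |have [P PQ /subsetP sP] := QB C CA];
  by rewrite !(def_pblock tQ PQ) // sP // imset_f.
by apply/subsetP=> y; rewrite inE => /H ->; rewrite mem_pblock.
Qed.

Lemma PI_compP (k : nat) (A B : PI k) (D : {set KK k}) :
  reflect (exists2 x, forall y, connect (glue A B) x y -> good_elt A B y
             & D = [set y | connect (glue A B) x (emb_out y)])
          (D \in PI_comp A B).
Proof.
apply: (iffP imsetP) => [[P]|[x gx ->]].
  rewrite inE => /andP[/PI_partsP[x ->] /forall_inP g ->]; exists x.
    by move=> y xy; apply: g; rewrite inE.
  by apply/setP=> y; rewrite !inE.
exists [set y | connect (glue A B) x y]; last by apply/setP=> y; rewrite !inE.
rewrite inE; apply/andP; split; first by apply/PI_partsP; exists x.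
by apply/forall_inP => y; rewrite inE; apply: gx.
Qed.

Lemma good_meets (k : nat) (A B : PI k) (x : K3 k) :
  (forall y, connect (glue A B) x y -> good_elt A B y) ->
  (exists a, connect (glue A B) x (inl (inl a))) /\
  (exists b, connect (glue A B) x (inr b)).
Proof.
move=> gx.
have mid j : connect (glue A B) x (inl (inr j)) ->
  (exists a, connect (glue A B) x (inl (inl a))) /\
  (exists b, connect (glue A B) x (inr b)).
  move=> xj; have /andP[/PI_coverP[C CA jC] /PI_coverP[D DB jD]] := gx _ xj.
  have [[a aC] _] := PI_block CA; have [_ [b bD]] := PI_block DB.
  split; [exists a|exists b]; apply: connect_trans xj _.
    exact: (glue_l B CA jC aC).
  exact: (glue_r A DB jD bD).
have := gx x (connect0 _ _); case: x gx mid => [[a|j]|b] gx mid /=.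
- move=> /PI_coverP[C CA aC]; have [_ [j jC]] := PI_block CA.
  exact: mid (glue_l B CA aC jC).
- by move=> _; apply: mid (connect0 _ _).
- move=> /PI_coverP[C CB bC]; have [[j jC] _] := PI_block CB.
  exact: mid (glue_r A CB bC jC).
Qed.

Lemma PI_comp_is_PI (k : nat) (A B : PI k) : is_PI (PI_comp A B).
Proof.
apply/andP; split; last first.
  apply/forall_inP => _ /PI_compP[x gx ->].
  have [[a ax] [b bx]] := good_meets gx.
  by apply/andP; split; apply/existsP; [exists a|exists b]; rewrite inE.
apply/and3P; split=> //.
  apply/trivIsetP=> _ _ /PI_compP[x _ ->] /PI_compP[y _ ->]; apply: contraR.
  case/pred0Pn=> z /andP[]; rewrite !inE => xz yz; apply/eqP/setP=> t; rewrite !inE.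
  have cs := glue_connect_sym A B.
  by rewrite (same_connect cs xz) (same_connect cs yz).
apply/negP=> /PI_compP[x gx]; have [[a ax] _] := good_meets gx.
by move/setP/(_ (inl a)); rewrite !inE => /esym; rewrite [connect _ _ _]ax.
Qed.

Definition PI_mul (k : nat) (A B : PI k) : PI k := MkPI (PI_comp_is_PI A B).

Lemma compatP (k : nat) (L : eqType) (z : L) (A : PI k) (c : KK k -> L) :
  reflect ((forall C x y, C \in (A : {set _}) -> x \in C -> y \in C -> c x = c y) /\
           (forall x, x \notin cover A -> c x = z))
          (compat z A c).
Proof.
apply: (iffP andP) => -[H1 H2]; split.
- move=> C x y CA xC yC; apply/eqP.
  by move: y yC; apply/forall_inP; move: x xC; apply/forall_inP; move: C CA; apply/forall_inP.
- by move=> x xA; apply/eqP; move: x xA; apply/forall_inP.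
- apply/forall_inP=> C CA; apply/forall_inP=> x xC; apply/forall_inP=> y yC.
  by rewrite (H1 C x y).
- by apply/forall_inP=> x xA; rewrite H2.
Qed.

Lemma PI_mul_coverP (k : nat) (A B : PI k) (x : KK k) :
  reflect (forall y, connect (glue A B) (emb_out x) y -> good_elt A B y)
          (x \in cover (PI_mul A B)).
Proof.
have cs := glue_connect_sym A B.
apply: (iffP (PI_coverP _ _)) => [[_ /PI_compP[u gu ->]]|gx].
  by rewrite inE => ux y xy; apply: gu; apply: connect_trans ux xy.
exists [set y | connect (glue A B) (emb_out x) (emb_out y)]; last by rewrite inE connect0.
by apply/PI_compP; exists (emb_out x).
Qed.

Lemma compat_mul (k : nat) (L : eqType) (z : L) (A B : PI k) (i l : 'I_k -> L) :
  compat z (PI_mul A B) (lab i l) <->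
  exists m : {ffun 'I_k -> L}, compat z A (lab i m) /\ compat z B (lab m l).
Proof.
have cs := glue_connect_sym A B; split.
  move=> /compatP[c1 c0]; set c := lab i l in c1 c0.
  pose g (u : K3 k) := if [pick y | connect (glue A B) u (emb_out y)] is Some y
                       then c y else z.
  have gout x : g (emb_out x) = c x.
    rewrite /g; case: pickP => [y xy|/(_ x)]; last by rewrite connect0.
    have [xc|xc] := boolP (x \in cover (PI_mul A B)).
      have /PI_coverP[D DAB xD] := xc; apply: (c1 D) => //.
      have /PI_compP[u _ DE] := DAB; move: xD; rewrite DE !inE => ux.
      exact: connect_trans ux xy.
    rewrite (c0 x xc) c0 //; apply: contra xc => /PI_mul_coverP gy.
    by apply/PI_mul_coverP=> t xt; apply: gy; rewrite -(same_connect cs xy).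
  have gconn u v : connect (glue A B) u v -> g u = g v.
    by move=> uv; rewrite /g (eq_pick (fun y => same_connect cs uv (emb_out y))).
  have gbad u : ~~ good_elt A B u -> g u = z.
    move=> nu; rewrite /g; case: pickP => // y uy; apply: c0.
    by apply: contra nu => /PI_mul_coverP; apply; rewrite cs.
  pose m := [ffun j => g (inl (inr j))].
  have gl x : lab i m x = g (emb_l x).
    by case: x => [a|j] /=; [exact: esym (gout (inl a))|rewrite ffunE].
  have gr x : lab m l x = g (emb_r x).
    by case: x => [j|b] /=; [rewrite ffunE|exact: esym (gout (inr b))].
  exists m; split; apply/compatP; split.
  - by move=> C x y CA xC yC; rewrite !gl; apply/gconn/(glue_l B CA xC yC).
  - by move=> x xA; rewrite gl gbad //; case: x xA => [a|j] /= /negPf ->.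
  - by move=> C x y CA xC yC; rewrite !gr; apply/gconn/(glue_r A CA xC yC).
  - by move=> x xA; rewrite gr gbad //; case: x xA => [a|j] /= /negPf ->; rewrite ?andbF.
case=> m [/compatP[A1 A0] /compatP[B1 B0]].
pose g (u : K3 k) := match u with
  | inl (inl a) => i a | inl (inr j) => m j | inr b => l b end.
have gl x : g (emb_l x) = lab i m x by case: x.
have gr x : g (emb_r x) = lab m l x by case: x.
have go x : g (emb_out x) = lab i l x by case: x.
have gconn : forall u v, connect (glue A B) u v -> g u = g v.
  apply: glue_ind => C x y CA xC yC; rewrite ?gl ?gr.
    exact: A1 CA xC yC.
  exact: B1 CA xC yC.
have gbad u : ~~ good_elt A B u -> g u = z.
  case: u => [[a|j]|b] /=; [exact: (A0 (inl a))| |exact: (B0 (inr b))].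
  by rewrite negb_and => /orP[/(A0 (inr j))|/(B0 (inl j))].
apply/compatP; split.
  move=> _ x y /PI_compP[u _ ->]; rewrite !inE => ux uy.
  by rewrite -!go -(gconn _ _ ux) (gconn _ _ uy).
move=> x xAB; rewrite -go.
have [/forallP H|] := boolP [forall y, connect (glue A B) (emb_out x) y ==> good_elt A B y].
  by case/PI_mul_coverP: xAB => y xy; apply: (implyP (H y)).
by rewrite negb_forall => /existsP[y]; rewrite negb_imply => /andP[/gconn -> /gbad].
Qed.

Lemma compat_block (k : nat) (A : PI k) (C : {set KK k}) :
  C \in (A : {set _}) -> compat false A (fun x => x \in C).
Proof.
move=> CA; apply/compatP; split=> [D x y DA xD yD|x]; last first.
  by apply: contraNF => xC; apply/PI_coverP; exists C.
by apply/idP/idP => H; [rewrite (PI_block_eq CA DA H xD)|rewrite (PI_block_eq CA DA H yD)].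
Qed.

Lemma PI_ext (k : nat) (A B : PI k) :
  (forall c : KK k -> bool, compat false A c = compat false B c) -> A = B.
Proof.
have sub (A' B' : PI k) : (forall c, compat false A' c = compat false B' c) ->
    forall C, C \in (A' : {set _}) -> C \in (B' : {set _}).
  move=> AB C CA; have [[a aC] _] := PI_block CA.
  have := compat_block CA; rewrite AB => /compatP[c1 c0].
  have /PI_coverP[D DB aD] : inl a \in cover B'.
    by apply: contraT => /c0; rewrite aC.
  suff -> : C = D by [].
  have := compat_block DB; rewrite -AB => /compatP[d1 _].
  by apply/setP=> x; apply/idP/idP => H;
    [rewrite (d1 C x (inl a))|rewrite (c1 D x (inl a))].
move=> AB; apply/val_inj/setP => C; apply/idP/idP; apply: sub => // c.
Qed.

Lemma eq_compat (k : nat) (L : eqType) (z : L) (A : PI k) (c d : KK k -> L) :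
  c =1 d -> compat z A c = compat z A d.
Proof.
move=> cd; apply/compatP/compatP => -[H1 H0]; split.
- by move=> C x y CA xC yC; rewrite -!cd (H1 C x y).
- by move=> x /H0; rewrite cd.
- by move=> C x y CA xC yC; rewrite !cd (H1 C x y).
- by move=> x /H0; rewrite cd.
Qed.

Lemma PI_mulA (k : nat) : associative (@PI_mul k).
Proof.
move=> A B C; apply: PI_ext => c.
have cE : c =1 lab (fun a => c (inl a)) (fun b => c (inr b)) by case.
rewrite !(eq_compat _ _ cE); apply/idP/idP.
  case/compat_mul => m [Am /compat_mul[p [Bp Cp]]].
  apply/compat_mul; exists p; split=> //; apply/compat_mul; by exists m.
case/compat_mul => m [/compat_mul[p [Ap Bp]] Cm].
apply/compat_mul; exists p; split=> //; apply/compat_mul; by exists m.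
Qed.

HB.instance Definition _ (k : nat) := isSemigroup.Build (PI k) (@PI_mulA k).

Definition PI_M (n k : nat) (A : PI k) (i : midx n k) : {set midx n k} :=
  [set l : midx n k | compat None A (lab i l)].

Definition PI_act (F : fieldType) (n k : nat) (A : PI k) : 'End(tensU F n k) :=
  linfun (lin_ext (fun i : midx n k => \sum_(l in PI_M A i) vT F l)).

Lemma PI_M_uniq (n k : nat) (A : PI k) (i l m : midx n k) :
  l \in PI_M A i -> m \in PI_M A i -> l = m.
Proof.
rewrite !inE => /compatP[l1 l0] /compatP[m1 m0]; apply/ffunP=> b.
have [/PI_coverP[C CA bC]|bA] := boolP (inr b \in cover A).
  have [[a aC] _] := PI_block CA.
  exact: etrans (esym (l1 _ _ _ CA aC bC)) (m1 _ _ _ CA aC bC).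
exact: etrans (l0 _ bA) (esym (m0 _ bA)).
Qed.

Lemma PI_act_vT (F : fieldType) (n k : nat) (A : PI k) (i : midx n k) :
  PI_act F n A (vT F i) = \sum_(l in PI_M A i) vT F l.
Proof. by rewrite lfunE /= lin_ext_basis. Qed.

Lemma PI_actM (F : fieldType) (n k : nat) (A B : PI k) :
  PI_act F n (A * B)%g = (PI_act F n B \o PI_act F n A)%VF.
Proof.
apply: lfun_basis_eq => i; rewrite comp_lfunE -[basisv F i]/(vT F i) !PI_act_vT.
rewrite linear_sum /=; under [RHS]eq_bigr do rewrite PI_act_vT.
have MM l : (l \in PI_M (A * B)%g i) = [exists m in PI_M A i, l \in PI_M B m].
  rewrite inE; apply/idP/exists_inP => [/compat_mul[m [Am Bm]]|[m]].
    by exists m; rewrite inE.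
  by rewrite !inE => Am Bm; apply/compat_mul; exists m.
have [m mA|M0] := pickP (mem (PI_M A i)); last first.
  rewrite [RHS]big_pred0 // big_pred0 // => l; rewrite MM.
  by apply/exists_inP => -[m]; rewrite [_ \in _]M0.
rewrite [RHS](bigD1 m) //= [X in _ + X]big1 ?addr0; last first.
  by move=> p /andP[pA /eqP[]]; apply: PI_M_uniq pA mA.
apply: eq_bigl => l; rewrite MM; apply/exists_inP/idP => [[p pA]|]; last by exists m.
by rewrite (PI_M_uniq pA mA).
Qed.

(* Main.v *)
From HB Require Import structures.
Require Import Defs.
From mathcomp Require Import all_boot all_order all_algebra.
From mathcomp Require Import reals complex.
Set Implicit Arguments.
Unset Strict Implicit.
Unset Printing Implicit Defensive.
Import GRing.Theory.
Local Open Scope ring_scope.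

(** Both semigroups act on the basis of the tensor power, which is indexed by
    X = the multi-indices in {0, ..., n}^k, through injective partial maps of X:
    an element s sends the basis vector i to l when [rho s i l] holds, and to 0
    when no such l exists. Apart from the combinatorics of these two families of
    partial maps, everything is formal.

    Order a semigroup S acting in this way by inclusion of graphs: m <= s when
    rho m is contained in rho s. In both cases the elements s with [rho s i l], if
    there are any, form the up-set of a least one, m(i,l). Hence the (i,l) entry
    of the operator of sum_s a_s s is the sum of the a_s over s >= m(i,l). The
    zeta transform a |-> (m |-> sum_(s >= m) a_s) is unitriangular, hence
    bijective ([zeta_eq0], [zeta_surj]). Two conclusions follow.

    - The image of the semigroup algebra is the set of all matrices that vanish
      at (i,l) when no s relates i to l and otherwise depend on m(i,l) only
      ([alg_image_of_coef]).
    - The semigroup algebra acts faithfully iff every m is of the form m(i,l)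
      ([alg_rep_injE]).

    Commuting with a partial bijection t of X identifies the entries (i,l) and
    (t i, t l), and makes the (i,l) entry vanish if t fixes one of i, l while the
    other one is outside the range, respectively the domain, of t. So a matrix
    that commutes with T has the form required for the image of S as soon as T
    links any two pairs with the same m(i,l) and separates every pair that S does
    not relate ([commutant_alg_image]).

    For IS_n, the element m(i,l) is the partial map i_j |-> l_j defined on the
    nonzero entries of i only. For PI*_k, it is the partition of the places of the
    concatenation (i,l) into the level sets of the nonzero entries. Linking and
    separation are then symmetric: labellings with the same level sets are linked
    by the partial injection that renames the labels ([pattern_IS]), and
    multi-indices that are entrywise images under one partial injection are linked
    by a partition into level sets ([levels_exist]). A partial injection m is an
    m(i,l) iff its domain fits into k places, which for all m means n <= k; a
    partition m is an m(i,l) iff n labels suffice to tell its blocks apart, which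
    for all m means k <= n. *)

(** * Semigroups acting by partial bijections of a basis *)

Definition acts_by (F : fieldType) (X S : finType) (rho : S -> rel X)
  (op : S -> 'End({ffun X -> F^o})) : Prop :=
  forall s i l, op s (basisv F i) l = (rho s i l)%:R.

Definition rel_le (X S : finType) (rho : S -> rel X) : rel S :=
  fun m s => [forall i, forall l, rho m i l ==> rho s i l].

Definition min_at (X S : finType) (rho : S -> rel X) (m : S) (i l : X) : bool :=
  rho m i l && [forall s, rho s i l ==> rel_le rho m s].

Definition rel_faithful (X S : finType) (rho : S -> rel X) : Prop :=
  forall s t, (forall i l, rho s i l = rho t i l) -> s = t.

Definition has_minima (X S : finType) (rho : S -> rel X) : Prop :=
  forall s i l, rho s i l -> exists m, min_at rho m i l.

Definition pinj (X : Type) (r : rel X) : Prop :=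
  (forall i l l', r i l -> r i l' -> l = l') /\
  (forall i i' l, r i l -> r i' l -> i = i').

Definition rel_commute (X : Type) (r t : rel X) : Prop :=
  forall i l, (exists2 j, r i j & t j l) <-> (exists2 j, t i j & r j l).

Lemma rel_leP (X S : finType) (rho : S -> rel X) m s :
  reflect (forall i l, rho m i l -> rho s i l) (rel_le rho m s).
Proof.
apply: (iffP forallP) => [H i l|H i].
  by move/forallP/(_ l)/implyP: (H i).
by apply/forallP => l; apply/implyP; apply: H.
Qed.

Lemma min_atP (X S : finType) (rho : S -> rel X) m i l :
  reflect (rho m i l /\ forall s, rho s i l -> forall i' l', rho m i' l' -> rho s i' l')
          (min_at rho m i l).
Proof.
apply: (iffP andP) => -[mil H]; split=> //.
  by move=> s sil; apply/rel_leP; move/forallP/(_ s)/implyP: H; apply.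
by apply/forallP=> s; apply/implyP=> sil; apply/rel_leP; apply: H.
Qed.

Lemma min_at_rel (X S : finType) (rho : S -> rel X) m i l s :
  min_at rho m i l -> rho s i l = rel_le rho m s.
Proof.
move=> /min_atP[mil H]; apply/idP/rel_leP => [sil i' l'|]; last by apply.
exact: H.
Qed.

(** * The zeta transform of the inclusion order *)

Definition zeta (F : fieldType) (X S : finType) (rho : S -> rel X)
  (a : {ffun S -> F^o}) : {ffun S -> F^o} :=
  [ffun m => \sum_(s | rel_le rho m s) a s].

Lemma zeta_is_linear (F : fieldType) (X S : finType) (rho : S -> rel X) :
  linear (@zeta F X S rho).
Proof.
move=> c a b; apply/ffunP => m; rewrite !ffunE /= scaler_sumr -big_split /=.
by apply: eq_bigr => s _; rewrite !ffunE.
Qed.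

HB.instance Definition _ (F : fieldType) (X S : finType) (rho : S -> rel X) :=
  GRing.isLinear.Build F {ffun S -> F^o} {ffun S -> F^o} _ (@zeta F X S rho)
    (@zeta_is_linear F X S rho).

(** Unitriangularity: if a is not 0, take m in its support with the largest graph;
    every s > m has a still larger graph, so a vanishes there and the value of the
    transform at m is a m. *)
Lemma zeta_eq0 (F : fieldType) (X S : finType) (rho : S -> rel X)
  (a : {ffun S -> F^o}) : rel_faithful rho -> zeta rho a = 0 -> a = 0.
Proof.
move=> inj za; apply/ffunP => s0; rewrite [RHS]ffunE; apply/eqP; apply: contraT => as0.
pose rk s := #|[set il : X * X | rho s il.1 il.2]|.
case: (arg_maxnP (P := fun s => a s != 0) rk as0) => m am mmax.
have := congr1 (fun b : {ffun S -> F^o} => b m) za; rewrite /zeta !ffunE.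
have mm : rel_le rho m m by apply/rel_leP.
rewrite (bigD1 m) //= big1 ?addr0 => [/eqP|s /andP[/rel_leP ms sm]].
  by rewrite (negPf am).
apply/eqP; apply: contraT => as_; have := mmax s as_.
rewrite /= leqNgt => /negP[]; apply: proper_card; apply/andP; split.
  by apply/subsetP=> il; rewrite !inE; apply: ms.
apply: contra sm => /subsetP sm; apply/eqP/inj => i l.
apply/idP/idP => [sil|]; last exact: ms.
by have := sm (i, l); rewrite !inE; apply.
Qed.

Lemma zeta_surj (F : fieldType) (X S : finType) (rho : S -> rel X)
  (b : {ffun S -> F^o}) : rel_faithful rho -> exists a, zeta rho a = b.
Proof.
move=> inj; pose z := linfun (@zeta F X S rho) : 'End({ffun S -> F^o}).
have kz : lker z == 0%VS.
  rewrite -subv0; apply/subvP => a; rewrite memv_ker memv0 lfunE /= => /eqP za.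
  by apply/eqP; apply: zeta_eq0 za.
have /memv_imgP[a _ ->] : b \in limg z by rewrite lker0_limgf // memvf.
by exists a; rewrite lfunE.
Qed.

(** * The image of the semigroup algebra, and its faithfulness *)

Lemma alg_rep_coef (F : fieldType) (X S : finType) (rho : S -> rel X)
  (op : S -> 'End({ffun X -> F^o})) a i l : acts_by rho op ->
  alg_rep op a (basisv F i) l = \sum_(s | rho s i l) a s.
Proof.
move=> opE; rewrite /alg_rep /lin_ext sum_lfunE sum_ffunE [RHS]big_mkcond /=.
apply: eq_bigr => s _; rewrite lfunE /= ffunE opE.
by case: (rho s i l); [apply: mulr1|apply: mulr0].
Qed.

Lemma alg_rep_coef_min (F : fieldType) (X S : finType) (rho : S -> rel X)
  (op : S -> 'End({ffun X -> F^o})) a m i l : acts_by rho op -> min_at rho m i l ->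
  alg_rep op a (basisv F i) l = zeta rho a m.
Proof.
move=> opE mil; rewrite (alg_rep_coef _ _ _ opE) ffunE; apply: eq_bigl => s.
exact: min_at_rel mil.
Qed.

Lemma alg_rep_coef_none (F : fieldType) (X S : finType) (rho : S -> rel X)
  (op : S -> 'End({ffun X -> F^o})) a i l : acts_by rho op ->
  (forall s, ~~ rho s i l) -> alg_rep op a (basisv F i) l = 0.
Proof.
by move=> opE nil; rewrite (alg_rep_coef _ _ _ opE) big_pred0 // => s; apply: negPf.
Qed.

(** The entries prescribed at the minimal elements form a function b on S (extended
    by 0), and a preimage of b under the zeta transform is an algebra element with
    the entries of f. *)
Lemma alg_image_of_coef (F : fieldType) (X S : finType) (rho : S -> rel X)
  (op : S -> 'End({ffun X -> F^o})) (f : 'End({ffun X -> F^o})) :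
  acts_by rho op -> rel_faithful rho -> has_minima rho ->
  (forall i l, (forall s, ~~ rho s i l) -> f (basisv F i) l = 0) ->
  (forall m i l i' l', min_at rho m i l -> min_at rho m i' l' ->
     f (basisv F i) l = f (basisv F i') l') ->
  alg_image op f.
Proof.
move=> opE inj hmin f0 fmin.
pose b : {ffun S -> F^o} := [ffun m =>
  if [pick il : X * X | min_at rho m il.1 il.2] is Some il
  then f (basisv F il.1) il.2 else 0].
have [a ab] := zeta_surj b inj; exists a.
apply: lfun_basis_eq => i; apply/ffunP => l.
have [/existsP[s /hmin[m mil]]|] := boolP [exists s, rho s i l].
  rewrite (alg_rep_coef_min _ opE mil) ab ffunE.
  case: pickP => [[i' l'] /= mil'|/(_ (i, l))]; last by rewrite mil.
  exact: fmin mil mil'.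
rewrite negb_exists => /forallP nil.
by rewrite (alg_rep_coef_none _ opE nil) f0.
Qed.

(** The entries of the operator of a are the values of the transform of a at the
    elements that are minimal at some pair. If all elements are, the operator
    determines the transform, hence a. If m is not, a preimage of the basis vector
    at m under the transform is a nonzero element of the kernel. *)
Lemma alg_rep_injE (F : fieldType) (X S : finType) (rho : S -> rel X)
  (op : S -> 'End({ffun X -> F^o})) :
  acts_by rho op -> rel_faithful rho -> has_minima rho ->
  injective (alg_rep op) <-> forall m, exists i l, min_at rho m i l.
Proof.
move=> opE inj hmin; split=> [alginj m|allmin a b ab].
  have [/existsP[i /existsP[l mil]]|nm] :=
    boolP [exists i, exists l, min_at rho m i l]; first by exists i, l.
  have nmil i l : ~~ min_at rho m i l.
    by apply: contra nm => H; apply/existsP; exists i; apply/existsP; exists l.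
  have [a am] := zeta_surj (basisv F m) inj.
  suff a0 : a = 0.
    have := congr1 (fun b : {ffun S -> F^o} => b m) am; rewrite a0 linear0 !ffunE eqxx.
    by move=> /esym/eqP; rewrite oner_eq0.
  apply: alginj; apply: lfun_basis_eq => i; apply/ffunP => l.
  have -> : alg_rep op 0 = 0 by rewrite /alg_rep linear0.
  rewrite lfunE ffunE /=.
  have [/existsP[s /hmin[m' mil]]|] := boolP [exists s, rho s i l].
    rewrite (alg_rep_coef_min _ opE mil) am ffunE; case: eqP => // mm'.
    by move: (nmil i l); rewrite mm' mil.
  rewrite negb_exists => /forallP nil; exact: alg_rep_coef_none opE nil.
apply/eqP; rewrite -subr_eq0; apply/eqP; apply: zeta_eq0 inj _.
apply/ffunP => m; have [i [l mil]] := allmin m.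
rewrite -(alg_rep_coef_min _ opE mil) /alg_rep linearB /= -!/(alg_rep _ _) ab subrr.
by rewrite lfunE !ffunE.
Qed.

(** * Commutants *)

Lemma op_basis (F : fieldType) (X S : finType) (rho : S -> rel X)
  (op : S -> 'End({ffun X -> F^o})) s i : acts_by rho op ->
  op s (basisv F i) = \sum_(l | rho s i l) basisv F l.
Proof.
move=> opE; rewrite [LHS]basisv_sum [RHS]big_mkcond; apply: eq_bigr => l _.
by rewrite opE; case: (rho s i l); rewrite ?scale1r ?scale0r.
Qed.

Lemma op_coef (F : fieldType) (X S : finType) (rho : S -> rel X)
  (op : S -> 'End({ffun X -> F^o})) s w l : acts_by rho op ->
  op s w l = \sum_(j | rho s j l) w j.
Proof.
move=> opE; rewrite {1}[w]basisv_sum linear_sum sum_ffunE [RHS]big_mkcond.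
apply: eq_bigr => j _; rewrite linearZ ffunE opE.
by case: (rho s j l); [apply: mulr1|apply: mulr0].
Qed.

Lemma intertwining_coef (F : fieldType) (X S : finType) (rho : S -> rel X)
  (op : S -> 'End({ffun X -> F^o})) (f : 'End({ffun X -> F^o})) s i l :
  acts_by rho op -> (f \o op s = op s \o f)%VF ->
  \sum_(j | rho s i j) f (basisv F j) l = \sum_(j | rho s j l) f (basisv F i) j.
Proof.
move=> opE fs; rewrite -(op_coef _ _ _ opE) -comp_lfunE -fs comp_lfunE.
by rewrite (op_basis _ _ opE) linear_sum sum_ffunE.
Qed.

Lemma big_unique (M : nmodType) (X : finType) (P : pred X) (g : X -> M) j :
  P j -> (forall j', P j' -> j' = j) -> \sum_(x | P x) g x = g j.
Proof.
move=> Pj uj; rewrite (bigD1 j) //= big1 ?addr0 // => x /andP[/uj ->].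
by rewrite eqxx.
Qed.

(** The two hypotheses on tau are the linking and the separation of pairs; each
    collapses the intertwining relation of [intertwining_coef] to one term or none
    on either side. *)
Lemma commutant_alg_image (F : fieldType) (X S T : finType)
  (rho : S -> rel X) (tau : T -> rel X)
  (opS : S -> 'End({ffun X -> F^o})) (opT : T -> 'End({ffun X -> F^o})) f :
  acts_by rho opS -> acts_by tau opT -> rel_faithful rho -> has_minima rho ->
  (forall t, pinj (tau t)) ->
  (forall m i l i' l', min_at rho m i l -> min_at rho m i' l' ->
     exists t, tau t i i' /\ tau t l l') ->
  (forall i l, (forall s, ~~ rho s i l) -> exists t,
     (tau t i i /\ forall j, ~~ tau t j l) \/ (tau t l l /\ forall j, ~~ tau t i j)) ->
  commutant opT f -> alg_image opS f.
Proof.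
move=> opSE opTE inj hmin tinj H1 H2 fT; apply: (alg_image_of_coef opSE inj hmin).
  move=> i l /H2[t tP]; have := intertwining_coef i l opTE (fT t).
  have [tf ti] := tinj t; case: tP => -[tr no].
    rewrite (big_unique _ tr) ?[RHS]big_pred0 // => [j|j' tj']; first exact: negPf (no j).
    exact: tf tj' tr.
  rewrite (big_pred0 _ _ _ _ (fun j => negPf (no j))) (big_unique (P := tau t ^~ l) _ tr) // => j' tj'.
  exact: ti tj' tr.
move=> m i l i' l' mil mil'; have [t [tii tll]] := H1 _ _ _ _ _ mil mil'.
have [tf ti] := tinj t; have := intertwining_coef i l' opTE (fT t).
rewrite (big_unique _ tii) ?(big_unique (P := tau t ^~ l') _ tll) // => [j tj|j tj].
  exact: ti tj tll.
exact: tf tj tii.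
Qed.

Lemma op_commute (F : fieldType) (X S T : finType)
  (rho : S -> rel X) (tau : T -> rel X)
  (opS : S -> 'End({ffun X -> F^o})) (opT : T -> 'End({ffun X -> F^o})) s t :
  acts_by rho opS -> acts_by tau opT -> pinj (rho s) -> pinj (tau t) ->
  rel_commute (rho s) (tau t) -> (opS s \o opT t = opT t \o opS s)%VF.
Proof.
have comp_coef (A B : finType) (al : A -> rel X) (be : B -> rel X)
    (opA : A -> 'End({ffun X -> F^o})) (opB : B -> 'End({ffun X -> F^o})) a b i l :
    acts_by al opA -> acts_by be opB -> pinj (be b) ->
    (opA a \o opB b)%VF (basisv F i) l = ([exists j, be b i j && al a j l])%:R.
  move=> opAE opBE [bf _]; rewrite comp_lfunE (op_coef _ _ _ opAE).
  have [/existsP[j /andP[bij ajl]]|] := boolP [exists j, be b i j && al a j l].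
    rewrite (bigD1 j) //= opBE bij big1 ?addr0 // => x /andP[_ xj].
    by rewrite opBE; case: (boolP (be b i x)) => // /(bf _ _ _ bij) jx; rewrite jx eqxx in xj.
  rewrite negb_exists => /forallP no; rewrite big1 // => x ax.
  by have := no x; rewrite ax andbT opBE => /negPf ->.
move=> opSE opTE sp tp st; apply: lfun_basis_eq => i; apply/ffunP => l.
rewrite (comp_coef _ _ _ _ _ _ _ _ _ _ opSE opTE tp) (comp_coef _ _ _ _ _ _ _ _ _ _ opTE opSE sp).
congr ((nat_of_bool _)%:R); apply/existsP/existsP => -[j /andP[j1 j2]].
  have [|y y1 y2] := (st i l).2; first by exists j.
  by exists y; rewrite y1.
have [|y y1 y2] := (st i l).1; first by exists j.
by exists y; rewrite y1.
Qed.

Lemma alg_image_commutant (F : fieldType) (X S T : finType)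
  (opS : S -> 'End({ffun X -> F^o})) (opT : T -> 'End({ffun X -> F^o})) f :
  (forall s t, (opS s \o opT t = opT t \o opS s)%VF) ->
  alg_image opS f -> commutant opT f.
Proof.
move=> st [a ->] t; rewrite /alg_rep /lin_ext comp_lfun_suml comp_lfun_sumr.
by apply: eq_bigr => s _; rewrite -comp_lfunZl st -comp_lfunZr.
Qed.

Lemma op_inj (F : fieldType) (X S : finType) (rho : S -> rel X)
  (op : S -> 'End({ffun X -> F^o})) :
  acts_by rho op -> rel_faithful rho -> injective op.
Proof.
move=> opE inj s t st; apply: inj => i l; have := opE t i l; rewrite -st opE.
by case: (rho s i l); case: (rho t i l) => // /eqP; rewrite ?oner_eq0 // eq_sym oner_eq0.
Qed.

(** * The partial maps given by IS_n and by PI*_k *)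

(** The extension of p to labels by 0 |-> 0, with [None] for 0. It never relates
    [None] to a nonzero label, although p may be undefined there. *)
Definition ext_rel (n : nat) (p : IS n) : rel (option 'I_n) := fun x y =>
  match x, y with
  | None, None => true
  | Some a, Some b => p a == Some b
  | _, _ => false
  end.

Definition IS_rel (n k : nat) (p : IS n) : rel (midx n k) :=
  fun i l => [forall j, ext_rel p (i j) (l j)].

Definition PI_rel (n k : nat) (A : PI k) : rel (midx n k) :=
  fun i l => compat None A (lab i l).

Lemma IS_injP (n : nat) (p : IS n) a a' b : p a = Some b -> p a' = Some b -> a = a'.
Proof.
move=> pa pa'; have /forallP/(_ a)/forallP/(_ a')/implyP := IS_inj p.
by rewrite pa pa' eqxx => /(_ isT)/eqP.
Qed.

Lemma ext_rel_pinj (n : nat) (p : IS n) : pinj (ext_rel p).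
Proof.
split; first by move=> [a|] [b|] [b'|] //= /eqP -> /eqP.
by move=> [a|] [b|] [b'|] //= /eqP pa /eqP pb; rewrite (IS_injP pa pb).
Qed.

Lemma IS_rel_pinj (n k : nat) (p : IS n) : pinj (@IS_rel n k p).
Proof.
have [pf pi] := ext_rel_pinj p.
split=> [i l l' /forallP il /forallP il'|i i' l /forallP il /forallP il'];
  apply/ffunP => j; [exact: pf (il j) (il' j)|exact: pi (il j) (il' j)].
Qed.

Lemma U_act_coef (F : fieldType) (n : nat) (p : IS n) x y :
  coordU (U_act p (eU F x)) y = (ext_rel p x y)%:R.
Proof.
case: x => [a|]; last first.
  case: y => [b|] //=; rewrite /V_act big1 ?mxE // => a _.
  by rewrite mxE scale0r.
case: y => [b|] //=; rewrite /V_act (bigD1 a) //= big1 => [|h /negPf ha]; last first.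
  by rewrite !mxE ha scale0r.
rewrite addr0 [delta_mx _ _ _ _]mxE !eqxx scale1r.
by case: (p a) => [b'|]; rewrite mxE ?andbT //= eq_sym.
Qed.

Lemma IS_acts_by (F : fieldType) (n k : nat) : acts_by (@IS_rel n k) (@IS_act F n k).
Proof.
move=> p i l; rewrite -[basisv F i]/(vT F i) -tens_eU IS_act_tens ffunE.
under eq_bigr do rewrite U_act_coef.
have [/forallP H|] := boolP (IS_rel p i l); first by rewrite big1 // => j _; rewrite H.
rewrite negb_forall => /existsP[j /negPf nj].
by rewrite (bigD1 j) //= nj mul0r.
Qed.

Lemma PI_acts_by (F : fieldType) (n k : nat) : acts_by (@PI_rel n k) (@PI_act F n k).
Proof.
move=> A i l; rewrite -[basisv F i]/(vT F i) PI_act_vT sum_ffunE.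
have [Ail|Ail] := boolP (PI_rel A i l).
  rewrite (bigD1 l) ?inE //= big1 ?addr0 => [|m /andP[_ /negPf ml]].
    by rewrite ffunE eqxx.
  by rewrite ffunE ml.
rewrite big1 // => m; rewrite inE ffunE; case: eqP => // -> Ail'.
by rewrite /PI_rel Ail' in Ail.
Qed.

(** * Elements adapted to a labelling *)

(** The condition for the level sets of c, except the one at z, to form an element
    of PI*_k. *)
Definition two_sided (k : nat) (L : eqType) (z : L) (c : KK k -> L) : Prop :=
  forall x, c x <> z ->
    (exists a, c (inl a) = c x) /\ (exists b, c (inr b) = c x).

Lemma compat_two_sided (k : nat) (L : eqType) (z : L) (A : PI k) (c : KK k -> L) :
  compat z A c -> two_sided z c.
Proof.
move=> /compatP[c1 c0] x cx.
have /PI_coverP[C CA xC] : x \in cover A.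
  by apply: contraT => /c0 xz; case: cx.
have [[a aC] [b bC]] := PI_block CA.
by split; [exists a|exists b]; apply: (c1 C).
Qed.

(** The witness consists of the level sets of c at the labels other than z; being
    compatible with it means factoring through c, with z sent to z'. *)
Lemma levels_exist (k : nat) (L : eqType) (z : L) (c : KK k -> L) :
  two_sided z c ->
  exists A : PI k, forall (L' : eqType) (z' : L') (d : KK k -> L'),
    compat z' A d <->
    (forall x y, c x = c y -> d x = d y) /\ (forall x, c x = z -> d x = z').
Proof.
move=> two; pose D := [set x | c x != z]; pose P := preim_partition c D.
have Ppart : partition P D := preim_partitionP c D.
have PI_P : is_PI P.
  rewrite /is_PI (cover_partition Ppart) Ppart; apply/forall_inP => _ /imsetP[x xD ->].
  have [|[a ax] [b bx]] := two x; first by apply/eqP; rewrite inE in xD.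
  move: xD; rewrite inE => xD.
  by apply/andP; split; apply/existsP; [exists a|exists b]; rewrite !inE ?ax ?bx xD eqxx.
have covE x : (x \in cover P) = (c x != z) by rewrite (cover_partition Ppart) inE.
exists (MkPI PI_P) => L' z' d; split=> [/compatP[d1 d0]|[d1 d0]].
  have dz x : c x = z -> d x = z' by move=> cx; apply: d0; rewrite /= covE cx eqxx.
  split=> // x y cxy; have [cx|cx] := eqVneq (c x) z.
    by rewrite !dz // -cxy.
  apply: (d1 [set y in D | c x == c y]); first by apply: imset_f; rewrite inE.
    by rewrite !inE cx eqxx.
  by rewrite !inE -cxy cx eqxx.
apply/compatP; split=> [C x y|x].
  move=> /imsetP[w _ ->]; rewrite !inE => /andP[_ /eqP wx] /andP[_ /eqP wy].
  by apply: d1; rewrite -wx.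
by rewrite /= covE negbK => /eqP; apply: d0.
Qed.

(** Two labellings with the same level sets and the same zeros differ by a renaming
    of the nonzero labels that occur. That renaming, defined on no other label, is
    the partial injection. *)
Lemma pattern_IS (n : nat) (J : finType) (c d : J -> option 'I_n) :
  (forall x y, c x = c y <-> d x = d y) -> (forall x, c x = None <-> d x = None) ->
  exists p : IS n, (forall x, ext_rel p (c x) (d x)) /\
    (forall a b, p a = Some b -> exists2 x, c x = Some a & d x = Some b).
Proof.
move=> cd cd0.
pose f : {ffun 'I_n -> option 'I_n} :=
  [ffun a => if [pick x | c x == Some a] is Some x then d x else None].
have fP a b : f a = Some b -> exists2 x, c x = Some a & d x = Some b.
  by rewrite ffunE; case: pickP => // x /eqP cx dx; exists x.
have finj : partial_inj f.
  apply/forallP => a; apply/forallP => a'; apply/implyP => /andP[/eqP faa'].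
  case fa: (f a) => [b|] // _; have [x cx dx] := fP _ _ fa.
  rewrite fa in faa'; have [x' cx' dx'] := fP _ _ (esym faa').
  apply/eqP; suff: Some a = Some a' by case.
  by rewrite -cx -cx'; apply/cd; rewrite dx.
exists (MkIS finj); split=> // x.
case cx: (c x) => [a|] /=; last by rewrite (iffLR (cd0 x)).
have fa : f a = d x.
  rewrite ffunE; case: pickP => [y /eqP cy|/(_ x)]; last by rewrite cx eqxx.
  by apply/cd; rewrite cy.
by case dx: (d x) => [b|] /=; [rewrite fa dx|move/cd0: dx; rewrite cx].
Qed.

(** * Faithfulness and commutation *)

Lemma IS_faithful (n k : nat) : (0 < k)%N -> rel_faithful (@IS_rel n k).
Proof.
move=> k0 p q pq; apply/val_inj/ffunP => a /=.
have pE (r : IS n) b :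
    IS_rel (k := k) r [ffun=> Some a] [ffun=> Some b] = (r a == Some b).
  apply/forallP/idP => [/(_ (Ordinal k0))|H j]; first by rewrite !ffunE.
  by rewrite !ffunE.
have H b : (p a == Some b) = (q a == Some b) by rewrite -!pE pq.
case pa: (p a) => [b|]; first by apply/esym/eqP; rewrite -H pa.
by case qa: (q a) => [b|] //; move: (H b); rewrite pa qa eqxx.
Qed.

(** The labellings with values in {0, 1} already determine an element of PI*_k
    ([PI_ext]), and n > 0 provides the label 1. *)
Lemma PI_faithful (n k : nat) : (0 < n)%N -> rel_faithful (@PI_rel n k).
Proof.
move=> n0 A B AB; apply: PI_ext => c; pose o : 'I_n := Ordinal n0.
pose g (b : bool) := if b then Some o else None.
have gE (C : PI k) :
    compat false C c = PI_rel C [ffun a => g (c (inl a))] [ffun b => g (c (inr b))].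
  rewrite /PI_rel (@eq_compat _ _ _ _ _ (g \o c)); last by case=> x /=; rewrite ffunE.
  have ginj : injective g by case; case.
  apply/compatP/compatP => -[c1 c0]; split=> [D x y DC xD yD|x xC].
  - by rewrite /= (c1 D x y).
  - by rewrite /= c0.
  - exact/ginj/(c1 D x y).
  - by apply: ginj; rewrite -[LHS]/((g \o c) x) c0.
by rewrite !gE AB.
Qed.

Lemma PI_rel_pinj (n k : nat) (A : PI k) : pinj (@PI_rel n k A).
Proof.
split=> [i l l' il il'|i i' l /compatP[l1 l0] /compatP[m1 m0]].
  by apply: (@PI_M_uniq _ _ A i); rewrite inE.
apply/ffunP=> a; have [/PI_coverP[C CA aC]|aA] := boolP (inl a \in cover A).
  have [_ [b bC]] := PI_block CA.
  exact: etrans (l1 _ _ _ CA aC bC) (esym (m1 _ _ _ CA aC bC)).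
exact: etrans (l0 _ aA) (esym (m0 _ aA)).
Qed.

Lemma compat_ext_rel (n k : nat) (p : IS n) (A : PI k) (c d : KK k -> option 'I_n) :
  (forall x, ext_rel p (c x) (d x)) -> compat None A c = compat None A d.
Proof.
move=> cd; have [pf pi] := ext_rel_pinj p.
have c0 x : c x = None <-> d x = None.
  by move: (cd x); case: (c x); case: (d x).
have c1 x y : c x = c y <-> d x = d y.
  split=> [cxy|dxy]; first by apply: pf (cd x) _; rewrite cxy.
  by apply: pi (cd x) _; rewrite dxy.
by apply/compatP/compatP => -[H1 H0]; split=> [C x y CA xC yC|x xA];
  [apply/c1/(H1 C)|apply/c0/H0|apply/c1/(H1 C)|apply/c0/H0].
Qed.

(** Compatibility with A depends only on level sets and zeros, so it is preserved by
    renaming all labels through p. The point is that p may be applied to all of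
    them once it may be applied on one side, because each nonzero label of a
    compatible labelling occurs on both sides. *)
Lemma IS_PI_commute (n k : nat) (p : IS n) (A : PI k) :
  rel_commute (@IS_rel n k p) (@PI_rel n k A).
Proof.
have lab2 (i i' l l' : midx n k) : IS_rel p i l -> IS_rel p i' l' ->
    forall x, ext_rel p (lab i i' x) (lab l l' x).
  by move=> /forallP il /forallP il' [a|b] /=.
move=> i l; split=> -[j].
  move=> pij Ajl.
  pose m : midx n k := [ffun b => odflt None [pick x | ext_rel p x (l b)]].
  have pml : IS_rel p m l.
    apply/forallP => b; rewrite ffunE; case: pickP => //= nb.
    case lb: (l b) => [y|] //; have [|[a /= al] _] := compat_two_sided Ajl (x := inr b).
      by rewrite /= lb.
    by have := nb (i a); rewrite -al (forallP pij).
  by exists m => //; rewrite /PI_rel (compat_ext_rel _ (lab2 _ _ _ _ pij pml)).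
move=> Aij pjl.
pose m : midx n k := [ffun a => odflt None [pick y | ext_rel p (i a) y]].
have pim : IS_rel p i m.
  apply/forallP => a; rewrite ffunE; case: pickP => //= na.
  case ia: (i a) => [y|] //; have [|_ [b /= bi]] := compat_two_sided Aij (x := inl a).
    by rewrite /= ia.
  by have := na (l b); rewrite -bi (forallP pjl).
by exists m => //; rewrite /PI_rel -(compat_ext_rel _ (lab2 _ _ _ _ pim pjl)).
Qed.

(** * Minimal partial injections *)

Lemma IS_restrict (n k : nat) (p : IS n) (i l : midx n k) : IS_rel p i l ->
  exists2 m : IS n, IS_rel m i l &
    forall a b, m a = Some b -> exists2 j, i j = Some a & l j = Some b.
Proof.
move=> /forallP pil; have [pf pi] := ext_rel_pinj p.
have [||m [m1 m2]] := @pattern_IS n 'I_k i l.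
- move=> x y; split=> e; first by apply: pf (pil x) _; rewrite e.
  by apply: pi (pil x) _; rewrite e.
- by move=> x; move: (pil x); case: (i x); case: (l x).
by exists m => //; apply/forallP.
Qed.

Lemma IS_rel_le (n k : nat) (m p : IS n) (i l : midx n k) :
  (forall a b, m a = Some b -> p a = Some b) -> IS_rel m i l -> IS_rel p i l.
Proof.
move=> mp /forallP mil; apply/forallP => j; move: (mil j).
by case: (i j) => [a|]; case: (l j) => [b|] //= /eqP/mp ->.
Qed.

Lemma IS_min_at (n k : nat) (m : IS n) (i l : midx n k) : IS_rel m i l ->
  (forall a b, m a = Some b -> exists2 j, i j = Some a & l j = Some b) ->
  min_at (@IS_rel n k) m i l.
Proof.
move=> mil mP; apply/min_atP; split=> // s /forallP sil i' l'; apply: IS_rel_le => a b.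
by move=> /mP[j ij lj]; move: (sil j); rewrite ij lj => /eqP.
Qed.

Lemma IS_has_minima (n k : nat) : has_minima (@IS_rel n k).
Proof. by move=> p i l /IS_restrict[m mil mP]; exists m; apply: IS_min_at. Qed.

(** Minimality forces m to be contained in its restriction to the entries of i.
    Constant multi-indices, which need k > 0, test this value by value. *)
Lemma IS_min_at_dom (n k : nat) (m : IS n) (i l : midx n k) : (0 < k)%N ->
  min_at (@IS_rel n k) m i l ->
  forall a b, m a = Some b -> exists2 j, i j = Some a & l j = Some b.
Proof.
move=> k0 /min_atP[mil mmin] a b mab; have [q qil qP] := IS_restrict mil.
apply: qP; have := mmin q qil [ffun=> Some a] [ffun=> Some b].
have mc : IS_rel m ([ffun=> Some a] : midx n k) [ffun=> Some b].
  by apply/forallP => j; rewrite !ffunE /= mab.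
by move=> /(_ mc)/forallP/(_ (Ordinal k0)); rewrite !ffunE => /eqP.
Qed.

(** If the identity is minimal at (i,l), all n labels occur among the k entries of
    i. Conversely, when n <= k the multi-index i can list the domain of m. *)
Lemma IS_all_minima (n k : nat) : (0 < k)%N ->
  (forall m : IS n, exists i l, min_at (@IS_rel n k) m i l) <-> (n <= k)%N.
Proof.
move=> k0; split=> [allmin|nk m].
  have [e p1] : exists p : IS n, forall a, ext_rel p (Some a) (Some a).
    by have [||p [p1 _]] := @pattern_IS n 'I_n (@Some _) (@Some _); try done; exists p.
  have [i [l /(IS_min_at_dom k0) dom]] := allmin e.
  have iP a : exists j, i j == Some a.
    by have /= /eqP aa := p1 a; have [j ij _] := dom a a aa; exists j; apply/eqP.
  pose g a := xchoose (iP a).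
  have ginj : injective g.
    move=> a a' gaa; have := eqP (xchooseP (iP a)); rewrite -/(g a) gaa.
    by rewrite (eqP (xchooseP (iP a'))) => -[].
  by have := leq_card g ginj; rewrite !card_ord.
pose i : midx n k := [ffun j : 'I_k => if insub (j : nat) is Some a then
                        if m a is Some _ then Some a else None else None].
pose l : midx n k := [ffun j : 'I_k => if insub (j : nat) is Some a then m a else None].
exists i, l; apply: IS_min_at.
  apply/forallP => j; rewrite !ffunE; case: insubP => //= a _ _.
  by case ma: (m a) => [b|] //=; rewrite ma.
move=> a b mab; exists (widen_ord nk a); rewrite ffunE /=;
  by rewrite (insubT (fun x => x < n)%N (ltn_ord a)) /=
     (_ : Sub _ _ = a) ?mab //; apply: val_inj.
Qed.

(** * Minimal partitions *)

Lemma PI_min_at (n k : nat) (m : PI k) (i l : midx n k) : PI_rel m i l ->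
  (forall d : KK k -> option 'I_n, compat None m d ->
     (forall x y, lab i l x = lab i l y -> d x = d y) /\
     (forall x, lab i l x = None -> d x = None)) ->
  min_at (@PI_rel n k) m i l.
Proof.
move=> mil mP; apply/min_atP; split=> // s /compatP[s1 s0] i' l' /mP[d1 d0].
apply/compatP; split=> [C x y CA xC yC|x xA]; first by apply: d1; apply: (s1 C).
by apply: d0; apply: s0.
Qed.

Lemma PI_levels (n k : nat) (A : PI k) (i l : midx n k) : PI_rel A i l ->
  exists m : PI k, forall d : KK k -> option 'I_n, compat None m d <->
     (forall x y, lab i l x = lab i l y -> d x = d y) /\
     (forall x, lab i l x = None -> d x = None).
Proof. by move=> /compat_two_sided/levels_exist[m mP]; exists m; apply: mP. Qed.

Lemma PI_has_minima (n k : nat) : has_minima (@PI_rel n k).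
Proof.
move=> A i l /PI_levels[m mP]; exists m; apply: PI_min_at; first exact/mP.
by move=> d /mP.
Qed.

(** Minimality of m at (i,l) is tested against the partition into level sets of
    (i,l): all labellings compatible with m must be compatible with the latter. *)
Lemma PI_min_at_levels (n k : nat) (m : PI k) (i l : midx n k) (d : KK k -> option 'I_n) :
  min_at (@PI_rel n k) m i l -> compat None m d ->
     (forall x y, lab i l x = lab i l y -> d x = d y) /\
     (forall x, lab i l x = None -> d x = None).
Proof.
move=> /min_atP[mil mmin] md; have [q qP] := PI_levels mil.
have qil : PI_rel q i l by apply/qP.
have dE : d =1 lab [ffun a => d (inl a)] [ffun b => d (inr b)].
  by case=> x; rewrite /= ffunE.
apply/qP; rewrite (eq_compat _ _ dE); apply: mmin qil _ _ _.
by rewrite /PI_rel -(eq_compat _ _ dE).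
Qed.

Lemma diag_two_sided (k : nat) (L : eqType) (z : L) (i : 'I_k -> L) :
  two_sided z (lab i i).
Proof. by case=> a _; split; exists a. Qed.

Lemma mem_pblock_cover (T : finType) (P : {set {set T}}) x y :
  y \in pblock P x -> x \in cover P.
Proof.
rewrite /pblock; case: pickP => [B /andP[BP xB] _|_]; last by rewrite inE.
by apply/bigcupP; exists B.
Qed.

(** If the identity partition is minimal at (i,l), the k entries of i are nonzero
    and distinct, since every labelling that agrees on both sides factors through
    that of (i,l). Conversely, k labels are enough to number the blocks. *)
Lemma PI_all_minima (n k : nat) : (0 < n)%N ->
  (forall m : PI k, exists i l, min_at (@PI_rel n k) m i l) <-> (k <= n)%N.
Proof.
move=> n0; split=> [allmin|kn m].
  have [e eP] := levels_exist (@diag_two_sided k _ None (fun a : 'I_k => Some a)).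
  have [i [l eil]] := allmin e.
  have dP (d : 'I_k -> option 'I_n) : compat None e (lab d d).
    by apply/eP; split=> [[x|x] [y|y] //= [->]|[x|x]].
  have [_ i0] := PI_min_at_levels eil (dP (fun=> Some (Ordinal n0))).
  have iinj : injective i.
    move=> a b iab; pose d x := if x == a then Some (Ordinal n0) else None.
    have [/(_ (inl a) (inl b) iab) + _] := PI_min_at_levels eil (dP d).
    by rewrite /= /d eqxx; case: eqP.
  have iS a : exists x, i a == Some x.
    by case ia: (i a) => [x|]; [exists x|have := i0 (inl a) ia].
  pose g a := xchoose (iS a).
  have ginj : injective g.
    move=> a a' gaa; apply: iinj.
    by rewrite (eqP (xchooseP (iS a))) (eqP (xchooseP (iS a'))) -/(g a) gaa.
  by have := leq_card g ginj; rewrite !card_ord.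
(* Number the blocks by an unprimed element of theirs; there are k <= n of those. *)
pose c (x : KK k) : option 'I_n :=
  if [pick a | inl a \in pblock m x] is Some a then Some (widen_ord kn a) else None.
have cN x : x \notin cover m -> c x = None.
  by rewrite /c; case: pickP => // a /mem_pblock_cover ->.
have c0 x : c x = None -> x \notin cover m.
  rewrite /c; case: pickP => // no _; apply/negP => xm.
  have [[a am] _] := PI_block (pblock_mem xm).
  by have := no a; rewrite am.
have c1 x y : c x = c y -> c x <> None -> pblock m x = pblock m y.
  rewrite /c; case: pickP => // a ax; case: pickP => // b bx [/val_inj ab] _.
  apply: (PI_block_eq (A := m) _ _ ax); last by rewrite ab.
    exact: pblock_mem (mem_pblock_cover ax).
  exact: pblock_mem (mem_pblock_cover bx).
have cE : c =1 lab [ffun a => c (inl a)] [ffun b => c (inr b)].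
  by case=> x; rewrite /= ffunE.
exists [ffun a => c (inl a)], [ffun b => c (inr b)]; apply: PI_min_at.
  rewrite /PI_rel -(eq_compat _ _ cE); apply/compatP; split=> [C x y Cm xC yC|x];
    last exact: cN.
  by rewrite /c !(def_pblock (PI_trivIset m) Cm).
move=> d /compatP[d1 d0]; have dn x : c x = None -> d x = None by move=> /c0/d0.
split=> [x y|x]; rewrite -!cE; last exact: dn.
have [cx|/eqP cx] := eqVneq (c x) None; first by move=> cy; rewrite !dn // -cy.
move=> cxy; have xy := c1 _ _ cxy cx.
have xm : x \in cover m by apply: contraT => /cN.
have ym : y \in cover m by apply: contraT => /cN; rewrite -cxy.
apply: (d1 (pblock m x)); rewrite ?pblock_mem ?mem_pblock //.
by rewrite xy mem_pblock.
Qed.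

(** * Linking and separation *)

(** A minimal m has for domain the set of nonzero entries of i, and likewise of i',
    so these agree and the level sets of (i,i') form an element of PI*_k. Applying
    m to all labels turns (i,i') into (l,l') without changing level sets. *)
Lemma IS_min_linked (n k : nat) (m : IS n) (i l i' l' : midx n k) : (0 < k)%N ->
  min_at (@IS_rel n k) m i l -> min_at (@IS_rel n k) m i' l' ->
  exists A : PI k, PI_rel A i i' /\ PI_rel A l l'.
Proof.
move=> k0 mil mil'; have dom := IS_min_at_dom k0 mil; have dom' := IS_min_at_dom k0 mil'.
have [/forallP mi _] := min_atP _ _ _ _ mil.
have [/forallP mi' _] := min_atP _ _ _ _ mil'.
have [|A AP] := @levels_exist k _ None (lab i i').
  case=> x /= ix; split; try by exists x.
    move: (mi x); case e: (i x) ix => [a|] // _; case: (l x) => [b|] //= /eqP.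
    by move=> /dom'[j ij _]; exists j.
  move: (mi' x); case e: (i' x) ix => [a|] // _; case: (l' x) => [b|] //= /eqP.
  by move=> /dom[j ij _]; exists j.
have Aii : PI_rel A i i' by apply/AP.
exists A; split=> //; rewrite /PI_rel -(@compat_ext_rel n k m A (lab i i')) //.
by case.
Qed.

(** Minimality makes the blocks of m the nonzero level sets of both (i,l) and
    (i',l'), so one renaming of labels takes the first to the second. *)
Lemma PI_min_linked (n k : nat) (m : PI k) (i l i' l' : midx n k) :
  min_at (@PI_rel n k) m i l -> min_at (@PI_rel n k) m i' l' ->
  exists p : IS n, IS_rel p i i' /\ IS_rel p l l'.
Proof.
move=> mil mil'.
have [mc _] := min_atP _ _ _ _ mil; have [mc' _] := min_atP _ _ _ _ mil'.
have [c1 c0] := PI_min_at_levels mil mc'; have [d1 d0] := PI_min_at_levels mil' mc.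
have [||p [pP _]] := @pattern_IS n (KK k) (lab i l) (lab i' l').
- by move=> x y; split; [apply: c1|apply: d1].
- by move=> x; split; [apply: c0|apply: d0].
by exists p; split; apply/forallP => j; [apply: (pP (inl j))|apply: (pP (inr j))].
Qed.

Lemma partial_id (n k : nat) (i : midx n k) : exists2 p : IS n, IS_rel p i i &
  forall a b, p a = Some b -> a = b /\ exists j, i j = Some a.
Proof.
have [||p [p1 p2]] := @pattern_IS n 'I_k i i; try done.
exists p; first exact/forallP.
by move=> a b /p2[j ij]; rewrite ij => -[ab]; split=> //; exists j.
Qed.

(** The partition into level sets of (i,i) fixes i, and has l in its range only if
    zeros of i and equalities between its entries persist in l. If this fails, the pair is
    separated; likewise with i and l exchanged. If both hold, i and l have the
    same pattern and some partial injection relates them. *)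
Lemma IS_unrelated_separated (n k : nat) (i l : midx n k) :
  (forall p : IS n, ~~ IS_rel p i l) -> exists A : PI k,
    (PI_rel A i i /\ forall j, ~~ PI_rel A j l) \/
    (PI_rel A l l /\ forall j, ~~ PI_rel A i j).
Proof.
move=> nil.
have [A AP] := levels_exist (@diag_two_sided k _ None i).
have [B BP] := levels_exist (@diag_two_sided k _ None l).
have Ai : PI_rel A i i by apply/AP.
have Bl : PI_rel B l l by apply/BP.
have [/existsP[m /AP[A1 A0]]|nA] := boolP [exists m : midx n k, PI_rel A m l]; last first.
  by exists A; left; split=> // m; apply: contra nA => H; apply/existsP; exists m.
have [/existsP[m' /BP[B1 B0]]|nB] := boolP [exists m : midx n k, PI_rel B i m]; last first.
  by exists B; right; split=> // m'; apply: contra nB => H; apply/existsP; exists m'.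
have [||p [p1 _]] := @pattern_IS n 'I_k i l.
- by move=> x y; split=> [/(A1 (inr x) (inr y))|/(B1 (inl x) (inl y))].
- by move=> x; split=> [/(A0 (inr x))|/(B0 (inl x))].
by have /negP[] := nil p; apply/forallP.
Qed.

(** The idempotent on the nonzero entries of i fixes i, and has l in its range only
    if every nonzero entry of l occurs in i. If this holds and so does the same
    with i and l exchanged, the level sets of (i,l) relate i to l. *)
Lemma PI_unrelated_separated (n k : nat) (i l : midx n k) :
  (forall A : PI k, ~~ PI_rel A i l) -> exists p : IS n,
    (IS_rel p i i /\ forall j, ~~ IS_rel p j l) \/
    (IS_rel p l l /\ forall j, ~~ IS_rel p i j).
Proof.
move=> nil; have [p pi pP] := partial_id i; have [q ql qP] := partial_id l.
have [/existsP[m /forallP pml]|np] := boolP [exists m : midx n k, IS_rel p m l]; last first.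
  by exists p; left; split=> // m; apply: contra np => H; apply/existsP; exists m.
have [/existsP[m' /forallP qim]|nq] := boolP [exists m : midx n k, IS_rel q i m]; last first.
  by exists q; right; split=> // m'; apply: contra nq => H; apply/existsP; exists m'.
have [|A AP] := @levels_exist k _ None (lab i l).
  case=> x /= ix; split; try by exists x.
    move: (qim x); case e: (i x) ix => [a|] // _; case: (m' x) => [b|] //= /eqP.
    by move=> /qP[_ [j ij]]; exists j.
  move: (pml x); case e: (l x) ix => [b|] // _; case: (m x) => [a|] //= /eqP.
  by move=> /pP[<- [j ij]]; exists j.
by have /negP[] := nil A; apply/AP.
Qed.

(** * The duality *)

Lemma duality_over_field (F : fieldType) (n k : nat) (hn : (0 < n)%N) (hk : (0 < k)%N) :
  (* (i) *)
  (forall (p : IS n) (A : PI k),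
     (IS_act F k p \o PI_act F n A = PI_act F n A \o IS_act F k p)%VF) /\
  (* (ii) *)
  (forall f : 'End(tensU F n k),
     commutant (@IS_act F n k) f <-> alg_image (@PI_act F n k) f) /\
  (* (iii) *)
  (forall f : 'End(tensU F n k),
     commutant (@PI_act F n k) f <-> alg_image (@IS_act F n k) f) /\
  (* (iv) *)
  injective (@IS_act F n k) /\
  (* (v) *)
  injective (@PI_act F n k) /\
  (* (vi) *)
  (injective (alg_rep (@IS_act F n k)) <-> (n <= k)%N) /\
  (* (vii) *)
  (injective (alg_rep (@PI_act F n k)) <-> (k <= n)%N).
Proof.
have ISa := @IS_acts_by F n k; have PIa := @PI_acts_by F n k.
have ISf := @IS_faithful n k hk; have PIf := @PI_faithful n k hn.
have ISm := @IS_has_minima n k; have PIm := @PI_has_minima n k.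
have comm p A :
    (IS_act F k p \o PI_act F n A = PI_act F n A \o IS_act F k p)%VF.
  exact: (op_commute ISa PIa (IS_rel_pinj k p) (PI_rel_pinj n A) (IS_PI_commute p A)).
split; [exact: comm|split; [|split; [|split; [|split; [|split]]]]].
- move=> f; split; last by apply: alg_image_commutant.
  apply: (commutant_alg_image PIa ISa PIf PIm (@IS_rel_pinj n k)).
    by move=> m i l i' l'; apply: PI_min_linked.
  by move=> i l; apply: PI_unrelated_separated.
- move=> f; split; last by apply: alg_image_commutant.
  apply: (commutant_alg_image ISa PIa ISf ISm (@PI_rel_pinj n k)).
    by move=> m i l i' l'; apply: IS_min_linked.
  by move=> i l; apply: IS_unrelated_separated.
- exact: op_inj ISa ISf.
- exact: op_inj PIa PIf.
- by rewrite (alg_rep_injE ISa ISf ISm); apply: IS_all_minima.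
- by rewrite (alg_rep_injE PIa PIf PIm); apply: PI_all_minima.
Qed.

Theorem theorem2 (R : realType) (n k : nat) (hn : (0 < n)%N) (hk : (0 < k)%N) :
  (* (i) *)
  (forall (p : IS n) (A : PI k),
     (IS_act R[i] k p \o PI_act R[i] n A = PI_act R[i] n A \o IS_act R[i] k p)%VF) /\
  (* (ii) *)
  (forall f : 'End(tensU R[i] n k),
     commutant (@IS_act R[i] n k) f <-> alg_image (@PI_act R[i] n k) f) /\
  (* (iii) *)
  (forall f : 'End(tensU R[i] n k),
     commutant (@PI_act R[i] n k) f <-> alg_image (@IS_act R[i] n k) f) /\
  (* (iv) *)
  injective (@IS_act R[i] n k) /\
  (* (v) *)
  injective (@PI_act R[i] n k) /\
  (* (vi) *)
  (injective (alg_rep (@IS_act R[i] n k)) <-> (n <= k)%N) /\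
  (* (vii) *)
  (injective (alg_rep (@PI_act R[i] n k)) <-> (k <= n)%N).
Proof. exact: duality_over_field. Qed.
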